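(* Let $\Delta$ be a combinatorial manifold, let $\sigma_0$ be a facet of $\Delta$, and let $p_1,\ldots,p_m$ be facet loops based at $\sigma_0$ whose homotopy classes generate the fundamental group $\pi_1(\Delta,\sigma_0)$. Then $\Pi(\Delta,\sigma_0)$ is generated by $\Pi_0(\Delta,\sigma_0)$ together with $\langle p_1\rangle,\ldots,\langle p_m\rangle$.
   Context: A simplicial complex on a vertex set $V$ is a non-empty collection $\Delta$ of finite subsets (simplices, faces) of $V$ closed under taking subsets; $\dim\sigma=\#\sigma-1$. A facet is an inclusion-maximal simplex; a ridge is a maximal proper face of a facet. The star $\mathrm{st}\,\sigma$ of a face $\sigma$ is the subcomplex generated by the facets containing $\sigma$; the link $\mathrm{lk}\,\sigma$ is the subcomplex of $\mathrm{st}\,\sigma$ of faces disjoint from $\sigma$. A finite $d$-dimensional simplicial complex $\Delta$ ($d\ge1$) is a combinatorial manifold if the link of each (non-empty) $k$-face is a simplicial sphere of dimension $d-k-1$. In particular manifolds are compact and without boundary. $\|\Delta\|$ denotes the geometric realization. Two distinct facets are adjacent iff they share a common ridge, i.e. iff $\sigma\cap\tau$ has exactly one element less than each of $\sigma,\tau$. For adjacent facets $\sigma,\tau$ let $v(\sigma,\tau)$ be the unique vertex in $\sigma\setminus\tau$. The perspectivity $\langle\sigma,\tau\rangle:\sigma\to\tau$ is the bijection sending $v(\sigma,\tau)$ to $v(\tau,\sigma)$ and fixing every other vertex of $\sigma$. A facet path is a sequence $g=(\sigma_0,\ldots,\sigma_n)$ of facets with consecutive ones adjacent; the projectivity along $g$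 is $\langle g\rangle=\langle\sigma_0,\sigma_1\rangle\cdots\langle\sigma_{n-1},\sigma_n\rangle$ (leftmost map applied first), a bijection from $\sigma_0$ to $\sigma_n$. A facet loop based at $\sigma_0$ is a facet path from $\sigma_0$ to $\sigma_0$. The group of projectivities $\Pi(\Delta,\sigma_0)\le\mathrm{Sym}(\sigma_0)$ is the group of all projectivities along facet loops based at $\sigma_0$. A facet path is identified with the path in $\|\Delta\|$ which runs, in the first barycentric subdivision, from the barycenter of $\sigma_i$ via the barycenter of the ridge $\sigma_i\cap\sigma_{i+1}$ to the barycenter of $\sigma_{i+1}$, for each $i$ (an edge path in the $1$-skeleton of the dual block complex). $\pi_1(\Delta,\sigma_0)$ is the fundamental group of $\|\Delta\|$ based at the barycenter of $\sigma_0$. The reduced group of projectivities $\Pi_0(\Delta,\sigma_0)$ is the subgroup of $\Pi(\Delta,\sigma_0)$ generated by the projectivities along null-homotopic facet loops based at $\sigma_0$. *)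

(* Defs.v *)
From HB Require Import structures.
From mathcomp Require Import all_boot all_order all_fingroup all_algebra.
From mathcomp Require Import generic_quotient.
From mathcomp Require Import all_classical all_reals topology normedtype.
From mathcomp Require Import continuous_path.
From mathcomp Require Import lra.

Set Implicit Arguments.
Unset Strict Implicit.
Unset Printing Implicit Defensive.

Import Order.TTheory GRing.Theory Num.Theory.
Import numFieldNormedType.Exports.

Local Open Scope classical_set_scope.
Local Open Scope ring_scope.
Local Open Scope quotient_scope.

Definition homeomorphic (T U : topologicalType) : Prop :=
  exists (f : T -> U) (g : U -> T),
    [/\ continuous f, continuous g, cancel f g & cancel g f].

Lemma continuous_set_type (T U : topologicalType) (A : set U) (f : T -> A) :
  continuous (fun x => set_val (f x)) -> continuous f.
Proof.
move=> cf x N [W [/= [B oB <-] Bfx] WN].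
by apply: (filterS WN); apply: cf; exact: open_nbhs_nbhs.
Qed.

Lemma set_val_continuous (T : topologicalType) (A : set T) :
  continuous (set_val : A -> T).
Proof. exact: initial_continuous. Qed.

Section UnitInterval.
Variable R : realType.

Definition unit_interval : Type := set_type `[0%R, (1 : R)]%classic.
HB.instance Definition _ := Topological.on unit_interval.

Definition ival (t : unit_interval) : R := set_val t.

Lemma ivalP t : 0 <= ival t <= 1.
Proof. by have := set_valP t; rewrite /= in_itv. Qed.

Lemma ival_inj : injective ival.
Proof. exact: val_inj. Qed.

Lemma ival_continuous : continuous ival.
Proof. exact: set_val_continuous. Qed.

Lemma clamp_subproof (x : R) :
  Num.max 0 (Num.min 1 x) \in `[0%R, (1 : R)]%classic.
Proof.
by apply/mem_set; rewrite /= in_itv /= le_max lexx /= ge_max ler01 ge_min lexx.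
Qed.

(* the retraction of the real line onto [0, 1] *)
Definition clamp (x : R) : unit_interval :=
  exist (fun r : R => r \in _) _ (clamp_subproof x).

Lemma clampE x : ival (clamp x) = Num.max 0 (Num.min 1 x).
Proof. by []. Qed.

Lemma clampK x : 0 <= x <= 1 -> ival (clamp x) = x.
Proof. by case/andP=> x0 x1; rewrite clampE (min_r x1) (max_r x0). Qed.

Lemma ivalK t : clamp (ival t) = t.
Proof. by apply: ival_inj; rewrite clampK ?ivalP. Qed.

Lemma clamp_continuous : continuous clamp.
Proof.
apply: (@continuous_set_type R R) => x.
apply: (@continuous_max R R (cst 0)); first exact: cvg_cst.
by apply: (@continuous_min R R (cst 1)); [exact: cvg_cst|exact: cvg_id].
Qed.

Lemma clamp01_neq : clamp 0 != clamp 1.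
Proof.
apply/eqP => /(congr1 ival); rewrite !clampK ?lexx ?ler01 // => /eqP.
by rewrite eq_sym oner_eq0.
Qed.

HB.instance Definition _ := isBiPointed.Build unit_interval clamp01_neq.

Lemma ival0 : ival zero = 0.
Proof. by rewrite clampK // lexx ler01. Qed.

Lemma ival1 : ival one = 1.
Proof. by rewrite clampK // lexx ler01. Qed.

End UnitInterval.

Section Paths.
Variables (R : realType) (T : topologicalType).
Local Notation I := (unit_interval R).
Implicit Types x y z : T.

Lemma paste_continuous (X Y : topologicalType) (phi : X -> R) (f g : X -> Y) :
  continuous phi -> continuous f -> continuous g ->
  (forall s, phi s = 1 / 2 -> f s = g s) ->
  continuous (fun s => if phi s <= 1 / 2 then f s else g s).
Proof.
move=> cphi cf cg fg; apply/continuous_subspace_setT.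
have -> : [set: X] = (phi @^-1` [set r | r <= 1 / 2]) `|`
                     (phi @^-1` [set r | r >= 1 / 2]).
  apply/seteqP; split=> // s _ /=; have [_|/ltW h] := leP (phi s) (1 / 2).
    by left.
  by right.
apply: withinU_continuous.
- by apply: closed_comp => [? _|]; [exact: cphi|exact: closed_le].
- by apply: closed_comp => [? _|]; [exact: cphi|exact: closed_ge].
- apply: (@subspace_eq_continuous _ _ _ f); last exact: continuous_subspaceT.
  move=> s /set_mem /= h. by rewrite /from_subspace h.
- apply: (@subspace_eq_continuous _ _ _ g); last exact: continuous_subspaceT.
  move=> s /set_mem /= h; rewrite /from_subspace; case: ifPn => // h'.
  by rewrite fg //; apply/eqP; rewrite eq_le h h'.
Qed.

Lemma comp_continuous (X Y Z : topologicalType) (f : X -> Y) (g : Y -> Z) :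
  continuous f -> continuous g -> continuous (fun s => g (f s)).
Proof. by move=> cf cg s; exact: (@continuous_comp _ _ _ f g s (cf s) (cg _)). Qed.

Lemma affine_continuous (X : topologicalType) (a b : R) (u : X -> R) :
  continuous u -> continuous (fun s => a * u s + b).
Proof.
move=> cu s; apply: (@cvgD R R); last exact: cvg_cst.
by apply: (@cvgM R); [exact: cvg_cst|exact: cu].
Qed.

Lemma clamp_scale_continuous (X : topologicalType) (a : R) (u : X -> R) :
  continuous u -> continuous (fun s => clamp (a * u s)).
Proof.
move=> cu; rewrite (_ : (fun s => _) = fun s => clamp (a * u s + 0)).
  by apply: (comp_continuous _ (@clamp_continuous R)); exact: affine_continuous.
by apply/funext => s; rewrite addr0.
Qed.

Lemma clamp_scaleB_continuous (X : topologicalType) (a b : R) (u : X -> R) :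
  continuous u -> continuous (fun s => clamp (a * u s - b)).
Proof.
move=> cu; apply: (comp_continuous _ (@clamp_continuous R)).
exact: affine_continuous.
Qed.

Lemma onem_continuous (X : topologicalType) (u : X -> R) :
  continuous u -> continuous (fun s => 1 - u s).
Proof. by move=> cu s; apply: (@cvgB R R); [exact: cvg_cst|exact: cu]. Qed.

Lemma clamp_onem_continuous (X : topologicalType) (u : X -> R) :
  continuous u -> continuous (fun s => clamp (1 - u s)).
Proof.
move=> cu; apply: (comp_continuous _ (@clamp_continuous R)).
exact: onem_continuous.
Qed.

Lemma path_continuous x y (f : {path I from x to y}) : continuous f.
Proof. exact: cts_fun. Qed.

Lemma path_clamp0 x y (f : {path I from x to y}) : f (clamp 0) = x.
Proof. exact: (@path_zero _ _ _ _ f). Qed.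

Lemma path_clamp1 x y (f : {path I from x to y}) : f (clamp 1) = y.
Proof. exact: (@path_one _ _ _ _ f). Qed.

Section Concat.
Variables (x y z : T).
Variables (f : {path I from x to y}) (g : {path I from y to z}).

Definition concat_fun (t : I) : T :=
  if ival t <= 1 / 2 then f (clamp (2 * ival t))
  else g (clamp (2 * ival t - 1)).

Lemma concat_continuous : continuous concat_fun.
Proof.
apply: paste_continuous; first exact: ival_continuous.
- apply: (comp_continuous _ (@path_continuous _ _ f)).
  exact: clamp_scale_continuous (@ival_continuous R).
- apply: (comp_continuous _ (@path_continuous _ _ g)).
  exact: clamp_scaleB_continuous (@ival_continuous R).
- move=> t ->; rewrite mulrC divfK ?pnatr_eq0 // subrr.
  by rewrite path_clamp1 path_clamp0.
Qed.

Lemma concat0 : concat_fun zero = x.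
Proof.
by rewrite /concat_fun ival0 mulr0 ifT ?divr_ge0 // path_clamp0.
Qed.

Lemma concat1 : concat_fun one = z.
Proof.
rewrite /concat_fun ival1 mulr1 ifF; last by apply/negP => ?; lra.
by rewrite (_ : 2 - 1 = 1) ?path_clamp1 //; lra.
Qed.

Definition concat : {path I from x to z} :=
  mk_path concat_continuous concat0 concat1.

End Concat.

Section Reverse.
Variables (x y : T) (f : {path I from x to y}).

Definition reverse_fun (t : I) : T := f (clamp (1 - ival t)).

Lemma reverse_continuous : continuous reverse_fun.
Proof.
apply: (comp_continuous _ (@path_continuous _ _ f)).
exact: clamp_onem_continuous (@ival_continuous R).
Qed.

Lemma reverse0 : reverse_fun zero = y.
Proof. by rewrite /reverse_fun ival0 subr0 path_clamp1. Qed.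

Lemma reverse1 : reverse_fun one = x.
Proof. by rewrite /reverse_fun ival1 subrr path_clamp0. Qed.

Definition reverse : {path I from y to x} :=
  mk_path reverse_continuous reverse0 reverse1.

End Reverse.

Definition const_path x : {path I from x to x} := cst x.

(* homotopy of paths relative to the endpoints *)
Definition homotopic x y (f g : {path I from x to y}) : Prop :=
  exists H : I * I -> T,
    [/\ continuous H,
        forall t, H (zero, t) = f t,
        forall t, H (one, t) = g t,
        forall s, H (s, zero) = x &
        forall s, H (s, one) = y].

Lemma fst_continuous (X Y : topologicalType) : continuous (@fst X Y).
Proof. by move=> ?; exact: cvg_fst. Qed.

Lemma snd_continuous (X Y : topologicalType) : continuous (@snd X Y).
Proof. by move=> ?; exact: cvg_snd. Qed.

Lemma pair_continuous (X Y Z : topologicalType) (f : X -> Y) (g : X -> Z) :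
  continuous f -> continuous g -> continuous (fun s => (f s, g s)).
Proof. by move=> cf cg s; apply: cvg_pair; [exact: cf|exact: cg]. Qed.

Lemma homotopic_refl x y (f : {path I from x to y}) : homotopic f f.
Proof.
exists (fun st => f st.2); split=> //.
- by apply: comp_continuous (@path_continuous _ _ f); exact: snd_continuous.
- by move=> s; exact: path_zero.
- by move=> s; exact: path_one.
Qed.

Lemma ival1_continuous : continuous (fun st : I * I => ival st.1).
Proof.
by apply: comp_continuous (@ival_continuous R); exact: fst_continuous.
Qed.

Lemma ival2_continuous : continuous (fun st : I * I => ival st.2).
Proof.
by apply: comp_continuous (@ival_continuous R); exact: snd_continuous.
Qed.

Lemma homotopic_sym x y (f g : {path I from x to y}) :
  homotopic f g -> homotopic g f.
Proof.
case=> H [cH Hf Hg H0 H1].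
exists (fun st => H (clamp (1 - ival st.1), st.2)); split=> //=.
- apply: comp_continuous cH.
  apply: pair_continuous; last exact: snd_continuous.
  exact: clamp_onem_continuous ival1_continuous.
- by move=> t; rewrite ival0 subr0 Hg.
- by move=> t; rewrite ival1 subrr Hf.
Qed.

Lemma homotopic_trans x y (f g h : {path I from x to y}) :
  homotopic f g -> homotopic g h -> homotopic f h.
Proof.
case=> H [cH Hf Hg H0 H1] [K [cK Kg Kh K0 K1]].
exists (fun st => if ival st.1 <= 1 / 2 then H (clamp (2 * ival st.1), st.2)
                  else K (clamp (2 * ival st.1 - 1), st.2)); split=> /=.
- apply: paste_continuous; first exact: ival1_continuous.
  + apply: comp_continuous cH.
    apply: pair_continuous; last exact: snd_continuous.
    exact: clamp_scale_continuous ival1_continuous.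
  + apply: comp_continuous cK.
    apply: pair_continuous; last exact: snd_continuous.
    exact: clamp_scaleB_continuous ival1_continuous.
  + move=> [s t] /= ->; rewrite mulrC divfK ?pnatr_eq0 // subrr.
    by rewrite Hg Kg.
- by move=> t; rewrite ival0 mulr0 ifT ?divr_ge0.
- move=> t; rewrite ival1 mulr1 ifF; last by apply/negP => ?; lra.
  by rewrite (_ : 2 - 1 = 1) ?Kh //; lra.
- by move=> s; case: ifP; rewrite ?H0 ?K0.
- by move=> s; case: ifP; rewrite ?H1 ?K1.
Qed.

Lemma homotopic_concat x y z (f f' : {path I from x to y})
    (g g' : {path I from y to z}) :
  homotopic f f' -> homotopic g g' -> homotopic (concat f g) (concat f' g').
Proof.
case=> H [cH Hf Hf' H0 H1] [K [cK Kg Kg' K0 K1]].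
exists (fun st => if ival st.2 <= 1 / 2 then H (st.1, clamp (2 * ival st.2))
                  else K (st.1, clamp (2 * ival st.2 - 1))); split=> /=.
- apply: paste_continuous; first exact: ival2_continuous.
  + apply: comp_continuous cH.
    apply: pair_continuous; first exact: fst_continuous.
    exact: clamp_scale_continuous ival2_continuous.
  + apply: comp_continuous cK.
    apply: pair_continuous; first exact: fst_continuous.
    exact: clamp_scaleB_continuous ival2_continuous.
  + move=> [s t] /= ->; rewrite mulrC divfK ?pnatr_eq0 // subrr.
    by rewrite H1 K0.
- by move=> t; rewrite Hf Kg.
- by move=> t; rewrite Hf' Kg'.
- by move=> s; rewrite ival0 mulr0 ifT ?divr_ge0.
- move=> s; rewrite ival1 mulr1 ifF; last by apply/negP => ?; lra.
  by rewrite (_ : 2 - 1 = 1) ?K1 //; lra.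
Qed.

Lemma homotopic_reverse x y (f g : {path I from x to y}) :
  homotopic f g -> homotopic (reverse f) (reverse g).
Proof.
case=> H [cH Hf Hg H0 H1].
exists (fun st => H (st.1, clamp (1 - ival st.2))); split=> /=.
- apply: comp_continuous cH.
  apply: pair_continuous; first exact: fst_continuous.
  exact: clamp_onem_continuous ival2_continuous.
- by move=> t; rewrite Hf.
- by move=> t; rewrite Hg.
- by move=> s; rewrite ival0 subr0 H1.
- by move=> s; rewrite ival1 subrr H0.
Qed.

(* straight-line homotopy between two reparametrizations of one path *)
Lemma homotopic_reparam x y u v (h : {path I from x to y})
    (f g : {path I from u to v}) (phi psi : I -> I) :
  continuous phi -> continuous psi ->
  phi zero = psi zero -> phi one = psi one ->
  (forall t, f t = h (phi t)) -> (forall t, g t = h (psi t)) ->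
  homotopic f g.
Proof.
move=> cphi cpsi e0 e1 fE gE.
exists (fun st => h (clamp (ival (phi st.2) +
  ival st.1 * (ival (psi st.2) - ival (phi st.2))))).
have c2 (k : I -> I) : continuous k -> continuous (fun st : I * I => ival (k st.2)).
  move=> ck.
  apply: (@comp_continuous _ _ _ (fun st : I * I => k st.2) _ _
            (@ival_continuous R)).
  by apply: (@comp_continuous _ _ _ snd k _ ck); exact: snd_continuous.
split=> /=.
- apply: comp_continuous (@path_continuous _ _ h).
  apply: comp_continuous (@clamp_continuous R).
  move=> st; apply: (@cvgD R R); first exact: c2.
  apply: (@cvgM R); first exact: ival1_continuous.
  by apply: (@cvgB R R); exact: c2.
- by move=> t; rewrite ival0 mul0r addr0 ivalK fE.
- by move=> t; rewrite ival1 mul1r addrC subrK ivalK gE.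
- by move=> s; rewrite e0 subrr mulr0 addr0 ivalK -e0 -fE path_zero.
- by move=> s; rewrite e1 subrr mulr0 addr0 ivalK -e1 -fE path_one.
Qed.

Lemma id_continuous (X : topologicalType) : continuous (fun s : X => s).
Proof. by move=> s; exact: cvg_id. Qed.

Lemma clamp_le0 (r : R) : r <= 0 -> clamp r = zero.
Proof.
move=> r0; apply: ival_inj; rewrite ival0 clampE min_r ?max_l //.
exact: le_trans r0 ler01.
Qed.

Lemma clamp_ge1 (r : R) : 1 <= r -> clamp r = one.
Proof.
by move=> r1; apply: ival_inj; rewrite ival1 clampE min_l ?max_r ?ler01.
Qed.

Lemma concat_constl x y (f : {path I from x to y}) :
  homotopic (concat (const_path x) f) f.
Proof.
apply: (@homotopic_reparam _ _ _ _ f _ _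
  (fun t => clamp (2 * ival t - 1)) idfun).
- exact: clamp_scaleB_continuous (@ival_continuous R).
- exact: id_continuous.
- by rewrite ival0 clamp_le0 //=; lra.
- by rewrite ival1 clamp_ge1 //=; lra.
- move=> t /=; rewrite /mk_path /concat_fun; case: ifPn => // t2.
  have -> : clamp (2 * ival t - 1) = zero by apply: clamp_le0; lra.
  by rewrite path_zero.
- by [].
Qed.

Lemma concat_constr x y (f : {path I from x to y}) :
  homotopic (concat f (const_path y)) f.
Proof.
apply: (@homotopic_reparam _ _ _ _ f _ _
  (fun t => clamp (2 * ival t)) idfun).
- exact: clamp_scale_continuous (@ival_continuous R).
- exact: id_continuous.
- by rewrite ival0 clamp_le0 //=; lra.
- by rewrite ival1 clamp_ge1 //=; lra.
- move=> t /=; rewrite /mk_path /concat_fun; case: ifPn => // t2.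
  have -> : clamp (2 * ival t) = one by apply: clamp_ge1; lra.
  by rewrite path_one.
- by [].
Qed.

Lemma concat_reverser x y (f : {path I from x to y}) :
  homotopic (concat f (reverse f)) (const_path x).
Proof.
apply: (@homotopic_reparam _ _ _ _ f _ _
  (fun t => if ival t <= 1 / 2 then clamp (2 * ival t)
            else clamp (2 * (1 - ival t))) (cst zero)).
- apply: (@paste_continuous I I (@ival R) (fun t => clamp _) (fun t => clamp _)).
  + exact: ival_continuous.
  + exact: clamp_scale_continuous (@ival_continuous R).
  + apply: (@clamp_scale_continuous I 2 (fun t => 1 - ival t)).
    exact: onem_continuous (@ival_continuous R).
  + by move=> t ->; congr clamp; lra.
- exact: cst_continuous.
- by rewrite ival0 ifT ?divr_ge0 // clamp_le0 //; lra.
- by rewrite ival1 ifF ?clamp_le0 //; [lra|apply/negP => ?; lra].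
- move=> t /=; rewrite /mk_path /concat_fun; case: ifPn => //=.
  rewrite /mk_path /reverse_fun -ltNge => t2; congr (f (clamp _)).
  by rewrite clampK; have := ivalP t; lra.
- by move=> t /=; rewrite path_zero.
Qed.

Lemma reverseK x y (f : {path I from x to y}) :
  reverse (reverse f) =1 f.
Proof.
move=> t; rewrite /reverse /= /mk_path /reverse_fun /= /mk_path /reverse_fun.
congr (f _); apply: ival_inj; have t01 := ivalP t.
by rewrite clampK clampK; lra.
Qed.

Lemma concat_reversel x y (f : {path I from x to y}) :
  homotopic (concat (reverse f) f) (const_path y).
Proof.
have := concat_reverser (reverse f); congr homotopic.
apply/path_eqP => t; rewrite /concat /= /mk_path /concat_fun.
by case: ifP => // _; rewrite reverseK.
Qed.

Lemma concatA x y z w (f : {path I from x to y}) (g : {path I from y to z})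
    (h : {path I from z to w}) :
  homotopic (concat f (concat g h)) (concat (concat f g) h).
Proof.
apply: (@homotopic_reparam _ _ _ _ (concat (concat f g) h) _ _
  (fun t => if ival t <= 1 / 2 then clamp (1 / 2 * ival t)
            else clamp (Num.max (1 * ival t - 1 / 4) (2 * ival t - 1))) idfun).
- apply: (@paste_continuous I I (@ival R) (fun t => clamp _) (fun t => clamp _)).
  + exact: ival_continuous.
  + exact: clamp_scale_continuous (@ival_continuous R).
  + apply: (@comp_continuous _ _ _ (fun t : I => Num.max _ _) _ _
              (@clamp_continuous R)) => t.
    by apply: (@continuous_max R I);
      exact: affine_continuous (@ival_continuous R) t.
  + by move=> t ->; congr clamp; rewrite max_l; lra.
- exact: id_continuous.
- by rewrite ival0 ifT ?divr_ge0 // clamp_le0 //; lra.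
- rewrite ival1 ifF ?clamp_ge1 //; last by apply/negP => ?; lra.
  by rewrite le_max; apply/orP; right; lra.
- move=> t /=; rewrite /mk_path /concat_fun /= /mk_path.
  have t01 := ivalP t.
  case: ifPn => [t2|]; last rewrite -ltNge => t2.
    rewrite ifT; last by rewrite clampK; lra.
    rewrite /concat_fun ifT; last by rewrite !clampK; lra.
    by congr (f (clamp _)); rewrite !clampK; lra.
  rewrite /concat_fun clampK; last lra.
  case: ifPn => [t4|]; last rewrite -ltNge => t4.
    rewrite max_l; last lra.
    rewrite clampK; last lra.
    rewrite ifT; last lra.
    rewrite clampK; last lra.
    rewrite ifF; last by apply/negP; lra.
    by congr (g (clamp _)); lra.
  rewrite max_r; last lra.
  rewrite clampK; last lra.
  rewrite ifF; last by apply/negP; lra.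
  by [].
- by [].
Qed.

End Paths.

Section FundamentalGroup.
Variables (R : realType) (T : topologicalType) (x : T).
Local Notation I := (unit_interval R).
Local Notation loop := {path I from x to x}.

Definition homotopic_rel : rel loop := fun f g => `[< homotopic f g >].

Lemma homotopic_rel_equiv : equiv_class_of homotopic_rel.
Proof.
split=> [f|f g|g f h].
- exact/asboolP/homotopic_refl.
- by apply/asboolP/asboolP; exact: homotopic_sym.
- by move=> /asboolP fg /asboolP gh; exact/asboolP/(homotopic_trans fg gh).
Qed.

Canonical homotopic_equiv := EquivRelPack homotopic_rel_equiv.

Definition pi1 : Type := {eq_quot homotopic_equiv}.
HB.instance Definition _ := Choice.on pi1.
HB.instance Definition _ := EqQuotient.on pi1.

Definition homotopy_class (f : loop) : pi1 := \pi_pi1 f.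

Lemma homotopy_classP (f g : loop) :
  homotopy_class f = homotopy_class g <-> homotopic f g.
Proof.
split=> [/eqmodP/asboolP//|fg].
exact/eqmodP/asboolP.
Qed.

Lemma homotopic_repr (f : loop) : homotopic (repr (homotopy_class f)) f.
Proof. by apply/homotopy_classP; rewrite /homotopy_class reprK. Qed.

Definition pi1_one : pi1 := homotopy_class (const_path R x).
Definition pi1_mul (a b : pi1) : pi1 :=
  homotopy_class (concat (repr a) (repr b)).
Definition pi1_inv (a : pi1) : pi1 := homotopy_class (reverse (repr a)).

Lemma pi1_mulE (f g : loop) :
  pi1_mul (homotopy_class f) (homotopy_class g) = homotopy_class (concat f g).
Proof. by apply/homotopy_classP/homotopic_concat; exact: homotopic_repr. Qed.

Lemma pi1_invE (f : loop) :
  pi1_inv (homotopy_class f) = homotopy_class (reverse f).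
Proof. by apply/homotopy_classP/homotopic_reverse; exact: homotopic_repr. Qed.

Lemma homotopy_class_surj (a : pi1) : exists f, a = homotopy_class f.
Proof. by exists (repr a); rewrite /homotopy_class reprK. Qed.

Lemma pi1_mulA : associative pi1_mul.
Proof.
move=> a b c; have [f ->] := homotopy_class_surj a.
have [g ->] := homotopy_class_surj b; have [h ->] := homotopy_class_surj c.
by rewrite !pi1_mulE; apply/homotopy_classP/concatA.
Qed.

Lemma pi1_mul1 : left_id pi1_one pi1_mul.
Proof.
move=> a; have [f ->] := homotopy_class_surj a.
by rewrite pi1_mulE; apply/homotopy_classP/concat_constl.
Qed.

Lemma pi1_1mul : right_id pi1_one pi1_mul.
Proof.
move=> a; have [f ->] := homotopy_class_surj a.
by rewrite pi1_mulE; apply/homotopy_classP/concat_constr.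
Qed.

Lemma pi1_mulV : left_inverse pi1_one pi1_inv pi1_mul.
Proof.
move=> a; have [f ->] := homotopy_class_surj a.
by rewrite pi1_invE pi1_mulE; apply/homotopy_classP/concat_reversel.
Qed.

Lemma pi1_Vmul : right_inverse pi1_one pi1_inv pi1_mul.
Proof.
move=> a; have [f ->] := homotopy_class_surj a.
by rewrite pi1_invE pi1_mulE; apply/homotopy_classP/concat_reverser.
Qed.

HB.instance Definition _ :=
  isGroup.Build pi1 pi1_mulA pi1_mul1 pi1_1mul pi1_mulV pi1_Vmul.

End FundamentalGroup.

Arguments pi1 R {T} x.

(* S generates G: a subgroup containing S is all of G *)
Definition generates (G : groupType) (S : set G) : Prop :=
  forall H : {pred G}, group_closed H -> (forall s, S s -> s \in H) ->
  forall a, a \in H.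

Section SimplicialComplex.
Variable V : finType.
Implicit Types (K : {set {set V}}) (rho sigma tau phi : {set V}).

Record simplicial_complex := SimplicialComplex {
  faces :> {set {set V}};
  _ : faces != finset.set0;
  _ : forall sigma tau, sigma \in faces -> tau \subset sigma -> tau \in faces
}.

Lemma faceW (D : simplicial_complex) sigma tau :
  sigma \in faces D -> tau \subset sigma -> tau \in faces D.
Proof. by case: D sigma tau. Qed.

Definition dim K : nat := (\max_(sigma in K) #|sigma|).-1.

Definition is_facet K sigma : bool := maxset (fun tau => tau \in K) sigma.

Definition star K sigma : {set {set V}} :=
  [set tau : {set V} | [exists phi : {set V}, [&& is_facet K phi, sigma \subset phi
                            & tau \subset phi]]]%SET.

Definition link K sigma : {set {set V}} :=
  [set tau in star K sigma | [disjoint tau & sigma]]%SET.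

Section Realization.
Variable R : realType.

Definition support (x : V -> R) : {set V} := [set v | x v != 0]%SET.

(* barycentric coordinates with respect to the vertex set V *)
Definition realization K : Type :=
  set_type [set x : {ptws V -> R} |
    [/\ forall v, 0 <= x v, \sum_v x v = 1 & support x \in K]].
HB.instance Definition _ K := Topological.on (realization K).

Definition coord K (p : realization K) (v : V) : R :=
  (set_val p : {ptws V -> R}) v.

Lemma coordP K (p : realization K) :
  [/\ forall v, 0 <= coord p v, \sum_v coord p v = 1 & support (coord p) \in K].
Proof. exact: (set_valP p). Qed.

Definition mk_point K (x : V -> R)
    (h : [/\ forall v, 0 <= x v, \sum_v x v = 1 & support x \in K]) :
    realization K :=
  exist (fun y : {ptws V -> R} => y \in _) x (mem_set h).

Lemma coord_mk_point K x h : coord (@mk_point K x h) = x.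
Proof. by []. Qed.

Lemma coord_inj K : injective (@coord K).
Proof. by move=> p q pq; apply: val_inj; exact: pq. Qed.

Lemma realization_continuous (X : topologicalType) K (f : X -> realization K) :
  (forall v, continuous (fun s => coord (f s) v)) -> continuous f.
Proof.
move=> cf; apply: continuous_set_type => s.
apply/cvg_sup.
move=> v; move: s.
apply/(@continuousP _ (initial_topology (fun y : V -> R => y v))) => A [B oB <-].
rewrite (_ : _ @^-1` _ = (fun s => coord (f s) v) @^-1` B) //.
by apply: open_comp => // s _; exact: cf.
Qed.

Definition bary_coord sigma : V -> R :=
  fun v => if v \in sigma then #|sigma|%:R^-1 else 0.

Lemma support_bary sigma : support (bary_coord sigma) = sigma.
Proof.
apply/setP => v; rewrite finset.inE /bary_coord; case: ifPn => [vs|_].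
  rewrite invr_eq0 pnatr_eq0 -lt0n; apply/card_gt0P.
  by exists v.
by rewrite eqxx.
Qed.

Lemma bary_subproof K sigma : sigma \in K -> sigma != finset.set0 ->
  [/\ forall v, 0 <= bary_coord sigma v, \sum_v bary_coord sigma v = 1
    & support (bary_coord sigma) \in K].
Proof.
move=> sK s0; split; last by rewrite support_bary.
- by move=> v; rewrite /bary_coord; case: ifP; rewrite ?invr_ge0 ?ler0n.
- rewrite /bary_coord -big_mkcond /= sumr_const -[_ *+ _]mulr_natl divff //.
  by rewrite pnatr_eq0 cards_eq0.
Qed.

Definition barycenter K sigma (sK : sigma \in K) (s0 : sigma != finset.set0) :
  realization K := mk_point (bary_subproof sK s0).

Section Edge.
Variables (D : simplicial_complex) (p q : realization D).
Hypothesis pq : support (coord p) :|: support (coord q) \in faces D.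

Definition edge_coord (t : R) : V -> R :=
  fun v => (1 - t) * coord p v + t * coord q v.

Lemma edge_subproof (t : unit_interval R) :
  [/\ forall v, 0 <= edge_coord (ival t) v, \sum_v edge_coord (ival t) v = 1
    & support (edge_coord (ival t)) \in faces D].
Proof.
have [p0 p1 pD] := coordP p; have [q0 q1 qD] := coordP q.
have /andP[t0 t1] := ivalP t; split.
- by move=> v; rewrite addr_ge0 // mulr_ge0 // subr_ge0.
- by rewrite big_split /= -!mulr_sumr p1 q1 !mulr1 subrK.
- apply: faceW pq _; apply/fintype.subsetP => v.
  rewrite !finset.inE /edge_coord; apply: contraNT.
  by rewrite negb_or !negbK => /andP[/eqP-> /eqP->]; rewrite !mulr0 addr0.
Qed.

Definition edge_fun (t : unit_interval R) : realization D :=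
  mk_point (edge_subproof t).

Lemma edge_continuous : continuous edge_fun.
Proof.
apply: realization_continuous => v.
have -> : (fun t => coord (edge_fun t) v) =
    fun t => (coord q v - coord p v) * ival t + coord p v.
  by apply/funext => t; rewrite coord_mk_point /edge_coord; lra.
exact: affine_continuous (@ival_continuous R).
Qed.

Lemma edge0 : edge_fun zero = p.
Proof.
apply: coord_inj; rewrite coord_mk_point; apply/funext => v.
by rewrite /edge_coord ival0 subr0 mul1r mul0r addr0.
Qed.

Lemma edge1 : edge_fun one = q.
Proof.
apply: coord_inj; rewrite coord_mk_point; apply/funext => v.
by rewrite /edge_coord ival1 subrr mul1r mul0r add0r.
Qed.

(* the straight segment from p to q inside a common simplex *)
Definition edge : {path unit_interval R from p to q} :=
  mk_path edge_continuous edge0 edge1.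

End Edge.

Definition sphere (n : nat) : Type :=
  set_type [set x : 'rV[R]_n | \sum_i x ord0 i ^+ 2 = 1].
HB.instance Definition _ n := Topological.on (sphere n).

(* The index n is one more than the dimension, so that the complex consisting of
   the empty face alone is the (-1)-sphere: [simplicial_sphere n K] says that K
   triangulates the unit sphere of R^n; no PL condition is imposed. *)
Definition simplicial_sphere (n : nat) K : Prop :=
  homeomorphic (realization K) (sphere n).

Record combinatorial_manifold := CombinatorialManifold {
  underlying :> simplicial_complex;
  _ : (1 <= dim underlying)%N;
  _ : forall sigma, sigma \in faces underlying -> sigma != finset.set0 ->
      (* #|sigma| = k + 1 for a k-face, hence the index is (dim - k - 1) + 1 *)
      simplicial_sphere ((dim underlying).+1 - #|sigma|) (link underlying sigma)
}.

End Realization.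

Definition facet K : Type := {sigma : {set V} | is_facet K sigma}.

(* equivalently, s and t are distinct and share a common ridge *)
Definition adjacent K (s t : facet K) : bool :=
  (#|val s :&: val t|.+1 == #|val s|) && (#|val s :&: val t|.+1 == #|val t|).

Lemma adjacent_sym K (s t : facet K) : adjacent s t -> adjacent t s.
Proof. by rewrite /adjacent finset.setIC andbC. Qed.

Definition vert sigma : Type := {v : V | v \in sigma}.

Lemma apex_subproof K (s t : facet K) : adjacent s t ->
  exists x : vert (val s), val x \notin val t.
Proof.
case/andP=> /eqP st _.
have /card_gt0P[v] : (0 < #|val s :\: val t|)%N.
  by rewrite finset.cardsD -st subSnn.
by rewrite finset.inE => /andP[vt vs]; exists (exist _ v vs).
Qed.

(* the unique vertex v(s, t) of s \ t *)
Definition apex K (s t : facet K) (st : adjacent s t) : vert (val s) :=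
  xchoose (apex_subproof st).

Lemma apexP K (s t : facet K) (st : adjacent s t) :
  val s :\: val t = [set val (apex st)]%SET.
Proof.
have at_ : val (apex st) \in val s :\: val t.
  by rewrite finset.inE (xchooseP (apex_subproof st)) (valP (apex st)).
have /eqP/cards1P[v vE] : #|val s :\: val t| = 1%N.
  by case/andP: (st) => /eqP st1 _; rewrite finset.cardsD -st1 subSnn.
by move: at_; rewrite vE finset.in_set1 => /eqP->.
Qed.

(* [insubd u x] is x if x lies in t, and u = v(t, s) otherwise *)
Definition perspectivity K (s t : facet K) (st : adjacent s t) :
  vert (val s) -> vert (val t) :=
  fun x => insubd (apex (adjacent_sym st)) (val x).

Lemma perspectivity_inj K (s t : facet K) (st : adjacent s t) :
  injective (perspectivity st).
Proof.
have out (x : vert (val s)) : val x \notin val t -> x = apex st.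
  move=> xt; apply: val_inj; apply/eqP.
  by rewrite -finset.in_set1 -apexP finset.inE xt (valP x).
have new : val (apex (adjacent_sym st)) \notin val s.
  exact: (xchooseP (apex_subproof (adjacent_sym st))).
move=> x y /(congr1 val); rewrite !val_insubd.
case: ifPn => xt; case: ifPn => yt.
- by move=> ?; apply: val_inj.
- by move=> xE; move: new; rewrite -xE (valP x).
- by move=> xE; move: new; rewrite xE (valP y).
- by rewrite (out x xt) (out y yt).
Qed.

(* facet paths (s = sigma_0, ..., sigma_n = t), by their first step *)
Inductive facet_path K : facet K -> facet K -> Type :=
| Stay s : facet_path s s
| Step s t u : adjacent s t -> facet_path t u -> facet_path s u.

Fixpoint projectivity K (s t : facet K) (g : facet_path s t) :
    vert (val s) -> vert (val t) :=
  match g in facet_path s t return vert (val s) -> vert (val t) with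
  | Stay _ => id
  | Step _ _ _ st g' => projectivity g' \o perspectivity st
  end.

Lemma projectivity_inj K (s t : facet K) (g : facet_path s t) :
  injective (projectivity g).
Proof.
elim: g => [{}s|{}s r {}t sr g IH]; first by move=> x y.
exact: inj_comp IH (@perspectivity_inj _ _ _ sr).
Qed.

Definition facet_loop K (s : facet K) : Type := facet_path s s.

Definition loop_perm K (s : facet K) (g : facet_loop s) :
  {perm vert (val s)} := perm (@projectivity_inj _ _ _ g).

Fixpoint facet_path_cat K (s t u : facet K) (g : facet_path s t) :
    facet_path t u -> facet_path s u :=
  match g in facet_path s t return facet_path t u -> facet_path s u with
  | Stay _ => id
  | Step _ _ _ st g' => fun h => Step st (facet_path_cat g' h)
  end.

Lemma projectivity_cat K (s t u : facet K) (g : facet_path s t)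
    (h : facet_path t u) :
  projectivity (facet_path_cat g h) = projectivity h \o projectivity g.
Proof. by elim: g h => [{}s|{}s r {}t sr g IH] h //=; rewrite IH. Qed.

Definition projectivity_group K (s : facet K) : {set {perm vert (val s)}} :=
  [set a | `[< exists g : facet_loop s, a = loop_perm g >]]%SET.

Lemma projectivity_group_set K (s : facet K) :
  group_set (projectivity_group s).
Proof.
apply/group_setP; split=> [|a b].
  rewrite finset.inE; apply/asboolP; exists (Stay s).
  by apply/permP => x; rewrite perm1 permE.
rewrite !finset.inE => /asboolP[g ->] /asboolP[h ->]; apply/asboolP.
exists (facet_path_cat g h); apply/permP => x.
by rewrite permM !permE projectivity_cat.
Qed.
Canonical projectivity_group_group K (s : facet K) :=
  Group (@projectivity_group_set K s).

Section Manifold.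
Variables (R : realType) (M : combinatorial_manifold R).
Local Notation I := (unit_interval R).
Implicit Types s t : facet M.

Lemma facet_face s : val s \in faces M.
Proof. exact: maxsetp (valP s). Qed.

Lemma facet_card_gt1 s : (1 < #|val s|)%N.
Proof.
have sM := facet_face s.
have smax tau : tau \in faces M -> val s \subset tau -> tau = val s.
  by have [_] := maxsetP (valP s); apply.
have d1 : (1 <= dim M)%N by case: (M).
rewrite ltnNge; apply/negP; rewrite leq_eqVlt ltnS leqn0 => /orP[/eqP s1|s0].
- have sn0 : val s != finset.set0 by rewrite -card_gt0 s1.
  have : simplicial_sphere R ((dim M).+1 - #|val s|) (link M (val s)).
    by case: (M) (val s) sM sn0 {smax d1} => D dD lkD sg; exact: lkD.
  rewrite s1 subn1 /=; case: (dim M) d1 => // n _ [f [g _]].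
  have eP : (delta_mx ord0 ord0 : 'rV[R]_n.+1) \in
      [set x : 'rV[R]_n.+1 | \sum_i x ord0 i ^+ 2 = 1].
    apply/mem_set => /=; rewrite (bigD1 ord0) //= mxE !eqxx expr1n.
    rewrite big1 ?addr0 // => i i0; rewrite mxE (negPf i0) andbF expr0n //.
  pose pt : sphere R n.+1 := exist (fun y : 'rV[R]_n.+1 => y \in _) _ eP.
  have [_ q1] := coordP (g pt).
  rewrite finset.inE => /andP[]; rewrite finset.inE => /existsP[phi].
  move=> /and3P[phiM sphi supp_phi] disj.
  have phiE : phi = val s by apply: smax => //; exact: maxsetp phiM.
  have supp0 : support (coord (g pt)) = finset.set0.
    apply/setP => v; rewrite finset.in_set0; apply/negP => vsupp.
    have := fintype.subsetP supp_phi v vsupp.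
    by rewrite phiE (disjointFr disj vsupp).
  have : (1 : R) = 0.
    rewrite -q1 big1 // => v _; apply/eqP; apply: contraT => v0.
    by rewrite -(finset.in_set0 v) -supp0 finset.inE.
  by move/eqP; rewrite oner_eq0.
- have sE : val s = finset.set0 by apply/eqP; rewrite -cards_eq0.
  suff /negP[] : ~~ (1 <= dim M)%N by [].
  rewrite -leqNgt /dim (_ : \max_(_ in _) _ = 0%N) //.
  apply/eqP; rewrite -leqn0; apply/bigmax_leqP => tau tauM.
  by rewrite (smax tau) // sE ?finset.sub0set ?cards0.
Qed.

Lemma facet_neq0 s : val s != finset.set0.
Proof. by rewrite -card_gt0; exact: ltnW (facet_card_gt1 s). Qed.

Definition facet_barycenter s : realization R M :=
  barycenter R (facet_face s) (facet_neq0 s).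

Section Ridge.
Variables (s t : facet M) (st : adjacent s t).

Lemma ridge_face : val s :&: val t \in faces M.
Proof. by apply: faceW (facet_face s) _; exact: finset.subsetIl. Qed.

Lemma ridge_neq0 : val s :&: val t != finset.set0.
Proof.
rewrite -card_gt0 -ltnS; case/andP: st => /eqP-> _; exact: facet_card_gt1.
Qed.

Definition ridge_barycenter : realization R M :=
  barycenter R ridge_face ridge_neq0.

Lemma facet_ridge_subproof :
  support (coord (facet_barycenter s)) :|: support (coord ridge_barycenter)
    \in faces M.
Proof.
by rewrite !support_bary (finset.setUidPl (finset.subsetIl _ _)) facet_face.
Qed.

Lemma ridge_facet_subproof :
  support (coord ridge_barycenter) :|: support (coord (facet_barycenter t))
    \in faces M.
Proof.
by rewrite !support_bary (finset.setUidPr (finset.subsetIr _ _)) facet_face.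
Qed.

Definition step_path :
    {path I from facet_barycenter s to facet_barycenter t} :=
  concat (edge facet_ridge_subproof) (edge ridge_facet_subproof).

End Ridge.

(* the edge path of the barycentric subdivision through the barycenters of the
   successive facets and ridges; its parametrization is immaterial up to
   homotopy *)
Fixpoint realize s t (g : facet_path s t) :
    {path I from facet_barycenter s to facet_barycenter t} :=
  match g in facet_path s t
    return {path I from facet_barycenter s to facet_barycenter t} with
  | Stay s => const_path R (facet_barycenter s)
  | Step _ _ _ st g' => concat (step_path st) (realize g')
  end.

Definition fundamental_group s : groupType := pi1 R (facet_barycenter s).

Definition loop_class s (g : facet_loop s) : fundamental_group s :=
  homotopy_class (realize g).

Definition null_homotopic s (g : facet_loop s) : Prop :=
  homotopic (realize g) (const_path R (facet_barycenter s)).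

Definition reduced_projectivity_group s : {set {perm vert (val s)}} :=
  <<[set a | `[< exists g : facet_loop s,
                   null_homotopic g /\ a = loop_perm g >]]%SET>>%g.

End Manifold.
End SimplicialComplex.

(* Main.v *)
From Pilot Require Import Defs.
From mathcomp Require Import all_boot all_order all_fingroup all_algebra.
From mathcomp Require Import all_classical all_reals.
From mathcomp Require Import topology continuous_path lra.

Set Implicit Arguments.
Unset Strict Implicit.
Unset Printing Implicit Defensive.

(** Reversing and concatenating facet paths corresponds, up to homotopy, to
    reversing and concatenating their realizations, so [loop_class] is
    compatible with both operations, and concatenating a facet loop with the
    reverse of a homotopic one gives a null-homotopic facet loop, whose
    projectivity lies in the reduced group.

    Let [G] be the group generated by the reduced group and the projectivities
    of the given loops. The homotopy classes that contain the realization of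
    some facet loop with projectivity in [G] form a subgroup of the fundamental
    group. It contains the classes of the given loops, hence is everything.
    So an arbitrary facet loop [g] is homotopic to a facet loop [h] whose
    projectivity is in [G]. The projectivity of [g] differs from that of [h] by
    a factor in the reduced group ([loop_perm_div_reduced]), so it is in [G]
    as well. *)

Section Reversal.
Local Open Scope ring_scope.
Local Open Scope classical_set_scope.
Import GRing.Theory Num.Theory Order.TTheory Pilot.Defs.

Lemma reverse_concat (R : realType) (T : topologicalType) (x y z : T)
    (f : {path unit_interval R from x to y})
    (g : {path unit_interval R from y to z}) :
  reverse (concat f g) = concat (reverse g) (reverse f).
Proof.
apply/path_eqP => t; have t01 := ivalP t.
rewrite /= /mk_path /reverse_fun /= /mk_path /concat_fun.
rewrite clampK; last lra.
case: (ltgtP (ival t) (1 / 2)) => [t2|t2|t2].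
- rewrite ifF; last by apply/negP; lra.
  rewrite /= /mk_path /reverse_fun.
  by congr (g (clamp _)); rewrite clampK; lra.
- rewrite ifT; last lra.
  rewrite /= /mk_path /reverse_fun.
  by congr (f (clamp _)); rewrite clampK; lra.
- rewrite t2 ifT; last lra.
  rewrite (_ : 2 * (1 - 1 / 2) = 1) ?path_clamp1; last lra.
  rewrite /= /mk_path /reverse_fun clampK; last lra.
  by rewrite (_ : 1 - 2 * (1 / 2) = 0) ?path_clamp0 //; lra.
Qed.

Variables (V : finType) (R : realType).

Lemma reverse_edge (D : simplicial_complex V) (p q : realization R D)
    (pq : support (coord p) :|: support (coord q) \in faces D)
    (qp : support (coord q) :|: support (coord p) \in faces D) :
  reverse (edge pq) = edge qp.
Proof.
apply/path_eqP => t; apply: coord_inj; apply/funext => v.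
have t01 := ivalP t.
rewrite /= /mk_path /reverse_fun /= /mk_path /edge_fun !coord_mk_point.
by rewrite /edge_coord clampK; lra.
Qed.

Variable M : combinatorial_manifold V R.
Implicit Types s t u : facet M.

Lemma ridge_barycenter_sym s t (st : adjacent s t) (ts : adjacent t s) :
  ridge_barycenter ts = ridge_barycenter st.
Proof. by apply: coord_inj; rewrite !coord_mk_point finset.setIC. Qed.

Lemma reverse_step_path s t (st : adjacent s t) (ts : adjacent t s) :
  reverse (step_path st) = step_path ts.
Proof.
rewrite reverse_concat /step_path.
move: (facet_ridge_subproof ts) (ridge_facet_subproof ts).
(* Only the two edges mention the midpoint of the reversed step, so it can be
   replaced by the midpoint of the original step without a transport. *)
rewrite (ridge_barycenter_sym st ts) => e1 e2.
by rewrite (reverse_edge _ e1) (reverse_edge _ e2).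
Qed.

Lemma realize_cat s t u (g : facet_path s t) (h : facet_path t u) :
  homotopic (realize (facet_path_cat g h)) (concat (realize g) (realize h)).
Proof.
elim: g h => [{}s|{}s r {}t sr g IH] h /=.
  exact/homotopic_sym/concat_constl.
apply: homotopic_trans (concatA _ _ _).
exact: homotopic_concat (homotopic_refl _) (IH h).
Qed.

Fixpoint facet_path_rev s t (g : facet_path s t) : facet_path t s :=
  match g in facet_path s t return facet_path t s with
  | Stay s => Stay s
  | Step _ _ _ st g' =>
      facet_path_cat (facet_path_rev g') (Step (adjacent_sym st) (Stay _))
  end.

Lemma realize_rev s t (g : facet_path s t) :
  homotopic (realize (facet_path_rev g)) (reverse (realize g)).
Proof.
elim: g => [{}s|{}s r {}t sr g IH] /=.
  rewrite (_ : reverse _ = const_path R (facet_barycenter s)).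
    exact: homotopic_refl.
  exact/path_eqP.
rewrite reverse_concat; apply: homotopic_trans (realize_cat _ _) _.
apply: homotopic_concat IH _.
rewrite (reverse_step_path _ (adjacent_sym sr)); exact: concat_constr.
Qed.

End Reversal.

Section Loops.
Local Open Scope group_scope.
Variables (V : finType) (R : realType) (M : combinatorial_manifold V R).
Variable s : facet M.
Implicit Types g h : facet_loop s.

Lemma loop_class_cat g h :
  loop_class (facet_path_cat g h) = loop_class g * loop_class h.
Proof.
rewrite /loop_class [RHS]pi1_mulE; exact/homotopy_classP/realize_cat.
Qed.

Lemma loop_class_rev g : loop_class (facet_path_rev g) = (loop_class g)^-1.
Proof.
rewrite /loop_class [RHS]pi1_invE; exact/homotopy_classP/realize_rev.
Qed.

Lemma null_homotopicE g : null_homotopic g <-> loop_class g = 1.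
Proof. by split=> [?|/homotopy_classP]; first exact/homotopy_classP. Qed.

Lemma loop_perm_Stay : loop_perm (Stay s) = 1.
Proof. by apply/permP => x; rewrite perm1 permE. Qed.

Lemma loop_perm_cat g h :
  loop_perm (facet_path_cat g h) = loop_perm g * loop_perm h.
Proof. by apply/permP => x; rewrite permM !permE projectivity_cat. Qed.

Lemma reduced_projectivity_group_sub :
  reduced_projectivity_group s \subset projectivity_group s.
Proof.
rewrite gen_subG; apply/fintype.subsetP => a; rewrite !finset.inE.
by move=> /asboolP[g [_ ->]]; apply/asboolP; exists g.
Qed.

(** The product is the projectivity of the null-homotopic loop that runs along
    [g] and then backwards along [h]. Writing the second factor as the
    projectivity of the reversed loop, instead of the inverse permutation,
    avoids inverting each perspectivity. *)
Lemma loop_perm_div_reduced g h : loop_class g = loop_class h ->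
  loop_perm g * loop_perm (facet_path_rev h) \in reduced_projectivity_group s.
Proof.
move=> gh; apply/mem_gen; rewrite finset.inE; apply/asboolP.
exists (facet_path_cat g (facet_path_rev h)); rewrite loop_perm_cat; split=> //.
by apply/null_homotopicE; rewrite loop_class_cat loop_class_rev gh divgg.
Qed.

Section Subgroup.
Variable G : {group {perm vert (val s)}}.
Hypothesis redG : reduced_projectivity_group s \subset G.

Lemma mem_loop_perm_rev g :
  (loop_perm (facet_path_rev g) \in G) = (loop_perm g \in G).
Proof.
have := fintype.subsetP redG _ (loop_perm_div_reduced (erefl (loop_class g))).
by move=> gG; apply/idP/idP => k;
  [rewrite -(groupMr _ k)|rewrite -(groupMl _ k)].
Qed.

(** Up to a factor in the reduced group, the projectivity of a facet loop is
    determined by its homotopy class, and [G] absorbs this factor. *)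
Lemma mem_loop_perm_homotopic g h : loop_class g = loop_class h ->
  (loop_perm g \in G) = (loop_perm h \in G).
Proof.
move=> /loop_perm_div_reduced/(fintype.subsetP redG) ghG.
rewrite -(mem_loop_perm_rev h).
by apply/idP/idP => k; [rewrite -(groupMl _ k)|rewrite -(groupMr _ k)].
Qed.

Definition classes_over : {pred fundamental_group s} :=
  [pred a | `[< exists g, a = loop_class g /\ loop_perm g \in G >]].

Lemma classes_over_group_closed : group_closed classes_over.
Proof.
split=> [|a b].
  by apply/asboolP; exists (Stay s); rewrite loop_perm_Stay group1.
move=> /asboolP[g [-> gG]] /asboolP[h [-> hG]]; apply/asboolP.
exists (facet_path_cat g (facet_path_rev h)).
rewrite loop_class_cat loop_class_rev loop_perm_cat; split=> //.
by rewrite groupM ?mem_loop_perm_rev.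
Qed.

End Subgroup.
End Loops.

Theorem proposition3p1 (R : realType) (V : finType)
    (Delta : combinatorial_manifold V R) (sigma0 : facet Delta)
    (m : nat) (p : 'I_m -> facet_loop sigma0)
    (p_generates : generates
       (fun a : fundamental_group sigma0 => exists i, a = loop_class (p i))) :
  projectivity_group sigma0 =
  <<reduced_projectivity_group sigma0
    :|: [set loop_perm (p i) | i : 'I_m]>>%g.
Proof.
apply/eqP; rewrite finset.eqEsubset; apply/andP; split; last first.
  rewrite gen_subG finset.subUset reduced_projectivity_group_sub.
  apply/fintype.subsetP => _ /imsetP[i _ ->].
  by rewrite finset.inE; apply/asboolP; exists (p i).
set G := <<_>>%g.
have redG : reduced_projectivity_group sigma0 \subset G.
  exact: fintype.subset_trans (finset.subsetUl _ _) (@subset_gen _ _).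
have genG (a : fundamental_group sigma0) :
    (exists i, a = loop_class (p i)) ->
    a \in classes_over [group of G].
  move=> [i ->]; apply/asboolP; exists (p i); split=> //.
  by rewrite mem_gen // finset.inE imset_f ?orbT.
apply/fintype.subsetP => a; rewrite finset.inE => /asboolP[g ->].
have /asboolP[h [gh hG]] :=
  p_generates _ (classes_over_group_closed redG) genG (loop_class g).
by rewrite (mem_loop_perm_homotopic redG gh).
Qed.
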